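(* Let $X$ and $Y$ be two S-homotopy equivalent flows which are not necessarily cofibrant. Then the topological spaces $\mathbb{P}^-X$ and $\mathbb{P}^-Y$ are homotopy equivalent.
   Context: All spaces are compactly generated topological spaces (weak Hausdorff $k$-spaces). A flow $X$ consists of a compactly generated space $\mathbb{P}X$ (the path space), a discrete space $X^0$ (the set of states), continuous maps $s,t:\mathbb{P}X\to X^0$, and a continuous associative map $*:\{(x,y)\in\mathbb{P}X\times\mathbb{P}X;\ t(x)=s(y)\}\to\mathbb{P}X$ with $s(x*y)=s(x)$ and $t(x*y)=t(y)$. A morphism of flows $f:X\to Y$ consists of a set map $f^0:X^0\to Y^0$ and a continuous map $\mathbb{P}f:\mathbb{P}X\to\mathbb{P}Y$ compatible with $s$, $t$ and $*$. The set of morphisms of flows from $X$ to $Y$, viewed as a set of continuous maps $X^0\sqcup\mathbb{P}X\to Y^0\sqcup\mathbb{P}Y$ and equipped with the Kelleyfication of the compact-open topology, is denoted $\mathbf{FLOW}(X,Y)$. Two morphisms of flows $f,g:X\to Y$ are S-homotopy equivalent (S-homotopic) if there is a continuous map $H:[0,1]\to\mathbf{FLOW}(X,Y)$ with $H(0)=f$ and $H(1)=g$. Two flows $X$ and $Y$ are S-homotopy equivalent if there exist morphisms of flows $f:X\to Y$ and $g:Y\to X$ such that $g\circ f$ and $f\circ g$ are S-homotopic to the respective identities. The branching space $\mathbb{P}^-X$ of a flow $X$ is the compactly generated space equipped with a continuous map $h^-:\mathbb{P}X\to\mathbb{P}^-X$ universal among continuous maps $\phi$ from $\mathbb{P}X$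 to compactly generated spaces with $\phi(x)=\phi(x*y)$ whenever $t(x)=s(y)$ (it is the quotient of $\mathbb{P}X$ by the smallest equivalence relation with closed graph identifying $x$ with $x*y$). *)

(* Defs.v *)
From HB Require Import structures.
From mathcomp Require Import all_boot all_order all_algebra.
From mathcomp Require Import all_classical all_reals topology.
From mathcomp Require Import normedtype.

Set Implicit Arguments.
Unset Strict Implicit.
Unset Printing Implicit Defensive.

Import Order.TTheory GRing.Theory Num.Theory.
Import numFieldNormedType.Exports.

Local Open Scope classical_set_scope.
Local Open Scope ring_scope.

(* Compact means quasi-compact in the library; the test objects are the compact
   Hausdorff spaces. *)
Definition test_map (K X : topologicalType) (u : K -> X) : Prop :=
  [/\ compact [set: K], hausdorff_space K & continuous u].

Definition k_open (X : topologicalType) (U : set X) : Prop :=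
  forall (K : topologicalType) (u : K -> X), test_map u -> open (u @^-1` U).

Definition k_space (X : topologicalType) : Prop :=
  forall U : set X, k_open U -> open U.

Definition weak_hausdorff (X : topologicalType) : Prop :=
  forall (K : topologicalType) (u : K -> X), test_map u -> closed (range u).

Definition compactly_generated (X : topologicalType) : Prop :=
  weak_hausdorff X /\ k_space X.

Definition kelleyfication (X : Type) : Type := X.

Section Kelleyfication.
Context (X : topologicalType).

Lemma k_openT : @k_open X setT.
Proof. by move=> K u _; rewrite preimage_setT; exact: openT. Qed.

Lemma k_openI : setI_closed (@k_open X).
Proof.
by move=> A B oA oB K u tu; rewrite preimage_setI; apply: openI; auto.
Qed.

Lemma k_open_bigU (I : Type) (f : I -> set X) :
  (forall i, k_open (f i)) -> k_open (\bigcup_i f i).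
Proof.
move=> of_ K u tu; rewrite preimage_bigcup.
by apply: bigcup_open => i _; exact: of_.
Qed.

HB.instance Definition _ := Choice.on (kelleyfication X).
HB.instance Definition _ := isOpenTopological.Build (kelleyfication X)
  k_openT k_openI k_open_bigU.

End Kelleyfication.

(* The composition law is continuous for the topology that the set of
   composable pairs carries as a pullback of compactly generated spaces, i.e.
   the Kelleyfication of the subspace topology of the usual product. *)
Record flow := Flow {
  state : discreteTopologicalType;
  path_space : topologicalType;
  path_space_cg : compactly_generated path_space;
  source : path_space -> state;
  target : path_space -> state;
  source_continuous : continuous source;
  target_continuous : continuous target;
  composable : set (path_space * path_space) :=
    [set xy | target xy.1 = source xy.2];
  star : forall x y, target x = source y -> path_space;
  star_continuous : continuous
    ((fun z => @star (val z).1 (val z).2 (set_valP z))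
       : kelleyfication composable -> path_space);
  source_star : forall x y (xy : target x = source y),
    source (star xy) = source x;
  target_star : forall x y (xy : target x = source y),
    target (star xy) = target y;
  starA : forall x y z (xy : target x = source y) (yz : target y = source z)
    (xy_z : target (star xy) = source z) (x_yz : target x = source (star yz)),
    star xy_z = star x_yz
}.

Arguments source_continuous f : clear implicits.
Arguments target_continuous f : clear implicits.
Arguments star_continuous f : clear implicits.
Arguments composable f : clear implicits.
Arguments source {f} _.
Arguments target {f} _.
Arguments star {f} [x y] _.

Record flow_morphism (X Y : flow) := FlowMorphism {
  state_map : state X -> state Y;
  path_map : path_space X -> path_space Y;
  path_map_continuous : continuous path_map;
  source_path_map : forall x, source (path_map x) = state_map (source x);
  target_path_map : forall x, target (path_map x) = state_map (target x);
  path_map_star : forall x y (xy : target x = source y)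
    (fxy : target (path_map x) = source (path_map y)),
    path_map (star xy) = star fxy
}.

Arguments path_map_continuous X Y f : clear implicits.

Program Definition flow_id (X : flow) : flow_morphism X X :=
  @FlowMorphism X X idfun idfun _ _ _ _.
Next Obligation. by move=> X x. Qed.
Next Obligation. by []. Qed.
Next Obligation. by []. Qed.
Next Obligation.
by move=> X x y xy fxy; congr star; exact: Prop_irrelevance.
Qed.

Program Definition flow_comp (X Y Z : flow)
    (g : flow_morphism Y Z) (f : flow_morphism X Y) : flow_morphism X Z :=
  @FlowMorphism X Z (state_map g \o state_map f) (path_map g \o path_map f)
    _ _ _ _.
Next Obligation.
by move=> X Y Z g f x; apply: continuous_comp; exact: path_map_continuous.
Qed.
Next Obligation. by move=> X Y Z g f x /=; rewrite !source_path_map. Qed.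
Next Obligation. by move=> X Y Z g f x /=; rewrite !target_path_map. Qed.
Next Obligation.
move=> X Y Z g f x y xy gfxy /=.
have fxy : target (path_map f x) = source (path_map f y).
  by rewrite target_path_map source_path_map xy.
by rewrite (path_map_star xy fxy) (path_map_star fxy gfxy).
Qed.

(* The sigma type [total_space X], with the library's topology on dependent
   pairs, is the topological sum of the set of states and the path space. *)
Definition flow_part (X : flow) (b : bool) : topologicalType :=
  if b then (state X : topologicalType) else path_space X.

Definition total_space (X : flow) : topologicalType :=
  {b : bool & flow_part X b}.

Definition total_map (X Y : flow) (f : flow_morphism X Y) :
    {compact-open, total_space X -> total_space Y} :=
  fun z => let: existT b x := z in
    (if b return flow_part X b -> total_space Y
     then fun a => existT (flow_part Y) true (state_map f a)
     else fun x => existT (flow_part Y) false (path_map f x)) x.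

HB.instance Definition _ (X Y : flow) := gen_eqMixin (flow_morphism X Y).
HB.instance Definition _ (X Y : flow) := gen_choiceMixin (flow_morphism X Y).

(* [total_map] is injective, so that the initial topology it induces makes
   [flow_morphism X Y] a subspace of the space of maps between total spaces.
   The library's compact-open topology is defined on all functions and uses all
   quasi-compact subsets of the source. *)
Definition FLOW (X Y : flow) : topologicalType :=
  kelleyfication (initial_topology (@total_map X Y)).

(* Homotopies are total functions of a real parameter; continuity is only
   required on the unit interval and the values outside it are irrelevant. *)
Definition S_homotopic (R : realType) (X Y : flow) (f g : flow_morphism X Y) :
    Prop :=
  exists H : R -> FLOW X Y,
    [/\ {within `[0, 1], continuous H}, H 0 = f & H 1 = g].

Definition S_homotopy_equivalent (R : realType) (X Y : flow) : Prop :=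
  exists (f : flow_morphism X Y) (g : flow_morphism Y X),
    S_homotopic R (flow_comp g f) (flow_id X) /\
    S_homotopic R (flow_comp f g) (flow_id Y).

Definition homotopic (R : realType) (A B : topologicalType) (f g : A -> B) :
    Prop :=
  exists H : R * A -> B,
    [/\ {within `[0, 1] `*` [set: A], continuous H},
        forall a, H (0, a) = f a & forall a, H (1, a) = g a].

Definition homotopy_equivalent (R : realType) (A B : topologicalType) : Prop :=
  exists (f : A -> B) (g : B -> A),
    [/\ continuous f, continuous g,
        homotopic R (g \o f) idfun & homotopic R (f \o g) idfun].

Definition branching_compatible (X : flow) (Z : Type) (phi : path_space X -> Z)
  : Prop := forall x y (xy : target x = source y), phi x = phi (star xy).

(* The branching space is specified by its universal property; existence is
   [branching_spaceP] at the end of this file. *)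
Definition is_branching_space (X : flow) (B : topologicalType)
    (h : path_space X -> B) : Prop :=
  [/\ compactly_generated B, continuous h, branching_compatible h &
      forall (Z : topologicalType) (phi : path_space X -> Z),
        compactly_generated Z -> continuous phi -> branching_compatible phi ->
        exists! psi : B -> Z, continuous psi /\ psi \o h = phi].

Lemma proj_closed (K S : topologicalType) (C : set (K * S)) (N : set K) :
  compact [set: K] -> closed C -> closed N ->
  closed [set x | exists2 k, N k & C (k, x)].
Proof.
move=> cK cC cN; rewrite -openC openE => x /= nx.
have cptN : compact N by apply: (subclosed_compact cN cK).
have /compact_near_coveringP := cptN.
move=> /(_ _ (nbhs x) (fun x k => ~ C (k, x)) _) H; rewrite /interior.
suff: \forall i \near nbhs x, N `<=` [set k | ~ C (k, i)].
  by move=> Hn; apply: filterS Hn => i Hi [k Nk Ck]; exact: (Hi k Nk Ck).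
apply: H => k Nk.
have nC : ~ C (k, x) by move=> Ckx; apply: nx; exists k.
have : nbhs (k, x) (~` C).
  by apply: open_nbhs_nbhs; split => //; exact: closed_openC.
by move=> [V nV sV]; exists V => // -[a b]; exact: sV.
Qed.

Lemma slice_closed (K S : topologicalType) (A : set (K * S)) :
  compact [set: K] -> hausdorff_space K ->
  (forall x, closed [set k | A (k, x)]) ->
  (forall N, closed N -> closed [set x | exists2 k, N k & A (k, x)]) ->
  closed A.
Proof.
move=> cK hK sA pA; rewrite -openC openE => -[k x] /= nA.
have : nbhs k (~` [set k | A (k, x)]).
  by apply: open_nbhs_nbhs; split => //; exact: closed_openC.
have := @compact_regular K k setT hK cK filterT.
move=> /[apply] -[N nN clN].
have := pA _ (@closed_closure _ N).
move=> /closed_openC oB.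
have nx : nbhs x (~` [set x | exists2 k, closure N k & A (k, x)]).
  by apply: open_nbhs_nbhs; split => // -[k' /clN].
exists (N, ~` [set x | exists2 k, closure N k & A (k, x)]) => //.
move=> [k' x'] /= [Nk' nex] Ak'.
by apply: nex; exists k' => //; exact: subset_closure.
Qed.

Lemma k_closedP (X : topologicalType) (C : set X) :
  k_open (~` C) <->
  forall (K : topologicalType) (u : K -> X), test_map u ->
    closed (u @^-1` C).
Proof.
by split=> H K u tu; have := H K u tu; rewrite -openC preimage_setC.
Qed.

Lemma closed_kelleyP (X : topologicalType) (C : set X) :
  closed (C : set (kelleyfication X)) <->
  forall (K : topologicalType) (u : K -> X), test_map u -> closed (u @^-1` C).
Proof. by rewrite -openC; exact: k_closedP. Qed.

Lemma k_space_closed (X : topologicalType) (C : set X) : k_space X ->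
  (forall (K : topologicalType) (u : K -> X), test_map u ->
    closed (u @^-1` C)) ->
  closed C.
Proof. by move=> kX /k_closedP/kX; rewrite openC. Qed.

Lemma closed_preimage (S T : topologicalType) (f : S -> T) (C : set T) :
  continuous f -> closed C -> closed (f @^-1` C).
Proof. by move=> /continuous_closedP; exact. Qed.

Lemma continuous_pair (S T U : topologicalType) (f : S -> T) (g : S -> U) :
  continuous f -> continuous g -> continuous (fun x => (f x, g x)).
Proof. by move=> cf cg x; apply: cvg_pair; [exact: cf | exact: cg]. Qed.

Lemma prod_hausdorff (S T : topologicalType) :
  hausdorff_space S -> hausdorff_space T -> hausdorff_space (S * T)%type.
Proof.
move=> hS hT [a b] [c d] cl; congr pair; [apply: hS|apply: hT] => A B nA nB.
- have nA' : nbhs (a, b) (fst @^-1` A)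
    by exact: (@cvg_fst _ _ (nbhs a) (nbhs b)).
  have nB' : nbhs (c, d) (fst @^-1` B)
    by exact: (@cvg_fst _ _ (nbhs c) (nbhs d)).
  by have [[x y] []] := cl _ _ nA' nB'; exists x.
- have nA' : nbhs (a, b) (snd @^-1` A)
    by exact: (@cvg_snd _ _ (nbhs a) (nbhs b)).
  have nB' : nbhs (c, d) (snd @^-1` B)
    by exact: (@cvg_snd _ _ (nbhs c) (nbhs d)).
  by have [[x y] []] := cl _ _ nA' nB'; exists y.
Qed.

Lemma kprod_closed (L X : topologicalType) (A : set (L * X)) :
  compact [set: L] -> hausdorff_space L -> k_space X ->
  (forall (K : topologicalType) (u : K -> L * X), test_map u ->
    closed (u @^-1` A)) ->
  closed A.
Proof.
move=> cL hL kX tA; apply: slice_closed => //.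
  move=> x; apply: (tA L (fun l => (l, x))); split => //.
  by apply: continuous_pair; [move=> ?|move=> ?; exact: cvg_cst].
move=> N cN; apply: k_space_closed => // M w [cM hM cw].
apply: (@proj_closed L M ((fun z => (z.1, w z.2)) @^-1` A)) => //.
apply: tA; split.
- by rewrite -setXTT; exact: compact_setX.
- exact: prod_hausdorff.
- apply: continuous_pair; first by move=> z; exact: cvg_fst.
  by move=> z; apply: continuous_comp; [exact: cvg_snd|exact: cw].
Qed.

Section quotient.
Context (X Q : topologicalType) (q : X -> Q).
Context (q_surj : forall y, exists x, q x = y).
Context (q_closed : forall C : set Q, closed (q @^-1` C) <-> closed C).

Lemma quotient_cts : continuous q.
Proof. by apply/continuous_closedP => C /q_closed. Qed.

Lemma whitehead (K : topologicalType) (A : set (K * Q)) :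
  compact [set: K] -> hausdorff_space K ->
  closed ((fun z => (z.1, q z.2)) @^-1` A : set (K * X)) -> closed A.
Proof.
move=> cK hK cA; apply: slice_closed => // [y|N cN]; last first.
  by apply/q_closed; exact: (proj_closed cK cA cN).
have [x <-] := q_surj y.
apply: (@closed_preimage _ _ (fun k => (k, x)) _ _ cA).
apply: continuous_pair; [by move=> ?|move=> ?; exact: cvg_cst].
Qed.

Context (kX : k_space X).

Lemma quotient_k_space : k_space Q.
Proof.
move=> U oU; rewrite -(setCK U) openC; apply/q_closed.
apply: k_space_closed => // K u [cK hK cu].
rewrite -openC -preimage_setC setCK; apply: (oU K (q \o u)); split => // k.
by apply: continuous_comp; [exact: cu | exact: quotient_cts].
Qed.

(* A quotient of a k-space by an equivalence relation whose graph is closed in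
   the Kelleyfied product is weak Hausdorff. *)
Lemma quotient_weak_hausdorff :
  closed ([set z | q z.1 = q z.2] : set (kelleyfication (X * X))) ->
  weak_hausdorff Q.
Proof.
move=> /closed_kelleyP cE K u [cK hK cu]; apply/q_closed.
apply: k_space_closed => // L v [cL hL cv].
have cG : closed [set z : L * Q | q (v z.1) = z.2].
  apply: whitehead => //; apply: kprod_closed => // M w [cM hM cw].
  apply: (cE M (fun m => (v (w m).1, (w m).2))); split => //.
  apply: continuous_pair => m.
    apply: continuous_comp; last exact: cv.
    by apply: continuous_comp; [exact: cw|exact: cvg_fst].
  by apply: continuous_comp; [exact: cw|exact: cvg_snd].
have cD : closed [set z : K * L | q (v z.2) = u z.1].
  apply: (@closed_preimage _ _ (fun z : K * L => (z.2, u z.1)) _ _ cG).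
  apply: continuous_pair => z; first exact: cvg_snd.
  by apply: continuous_comp; [exact: cvg_fst|exact: cu].
have := proj_closed cK cD (@closedT K); congr closed.
by apply/seteqP; split => l /= [k _ e]; exists k.
Qed.

End quotient.

Lemma set_type_compact (K : topologicalType) (N : set K) :
  compact [set: K] -> closed N -> compact [set: set_type N].
Proof.
move=> cK cN F FF _.
have FG := fmap_proper_filter (set_val : N -> K) FF.
have cptN : compact N by apply: (subclosed_compact cN cK).
have [|k [Nk clk]] := cptN (set_val @ F) FG.
  by apply: (@filterS _ F _ setT); [move=> z _; exact: set_valP|exact: filterT].
exists (exist _ k (mem_set Nk)); split => // A B FA [? [[W oW <-] /= Wk WB]].
have FA' : (set_val @ F) (set_val @` A).
  by apply: (@filterS _ F _ A) => // z Az; exists z.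
have [k' [[z Az zk] Wk']] := clk _ _ FA' (open_nbhs_nbhs (conj oW Wk)).
by exists z; split => //; apply: WB; rewrite /= zk.
Qed.

Lemma set_type_hausdorff (K : topologicalType) (N : set K) :
  hausdorff_space K -> hausdorff_space (set_type N).
Proof.
move=> hK x y cl; apply/val_inj/hK => A B nA nB.
have cv : continuous (set_val : N -> K) by exact: initial_continuous.
by have [z []] := cl _ _ (cv x _ nA) (cv y _ nB); exists (set_val z).
Qed.

Lemma weak_hausdorff_closed1 (Z : topologicalType) (z : Z) :
  weak_hausdorff Z -> closed [set z].
Proof.
move=> wZ; have : closed (range (cst z : discrete_topology unit -> Z)).
  apply: wZ; split; last by move=> ?; exact: cvg_cst.
    by apply: finite_compact; exact: finite_finset.
  exact: discrete_hausdorff.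
congr closed; apply/seteqP; split => [_ [_ _ <-]//|_ ->].
by exists tt.
Qed.

Lemma weak_hausdorff_eq_closed (Z M : topologicalType) (a b : M -> Z) :
  weak_hausdorff Z -> compact [set: M] -> hausdorff_space M ->
  continuous a -> continuous b -> closed [set m | a m = b m].
Proof.
move=> wZ cM hM ca cb; rewrite -openC openE => m /= ab.
have nbU : nbhs m [set m' | a m' <> b m].
  apply: open_nbhs_nbhs; split => //.
  apply: (@closed_openC _ (a @^-1` [set b m])).
  by apply: closed_preimage => //; exact: weak_hausdorff_closed1.
have [N nN clN] := @compact_regular M m setT hM cM filterT _ nbU.
have cN := @closed_closure _ N.
have cI : closed (range (a \o (set_val : closure N -> M))).
  apply: wZ; split; [exact: set_type_compact|exact: set_type_hausdorff|].
  by move=> z; apply: continuous_comp; [exact: initial_continuous|exact: ca].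
have nb : nbhs m (b @^-1` ~` range (a \o (set_val : closure N -> M))).
  apply: cb; apply: open_nbhs_nbhs; split; first exact: closed_openC.
  by move=> [z _ /= e]; apply: (clN (set_val z)) => //; exact: set_valP.
near=> m' => e.
have : (~` range (a \o (set_val : closure N -> M))) (b m') by near: m'.
apply; have Nm' : closure N m' by apply: subset_closure; near: m'.
by exists (exist _ m' (mem_set Nm')).
Unshelve. all: by end_near. Qed.

Section branching.
Local Open Scope quotient_scope.
Context (X : flow).
Let P := path_space X.

(* the smallest equivalence relation with closed graph, in the product of
   compactly generated spaces, that identifies x with x * y *)
Definition branching_rel (x x' : P) : Prop :=
  forall E : P -> P -> Prop,
    (forall x, E x x) -> (forall x y, E x y -> E y x) ->
    (forall x y z, E x y -> E y z -> E x z) ->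
    closed ([set z | E z.1 z.2] : set (kelleyfication (P * P))) ->
    (forall x y (xy : target x = source y), E x (star xy)) -> E x x'.

Let r (x x' : P) : bool := `[< branching_rel x x' >].

Local Lemma branching_rel_refl : reflexive r.
Proof. by move=> x; apply/asboolP => E ? *. Qed.

Local Lemma branching_rel_sym : symmetric r.
Proof.
have H x y : r x y -> r y x.
  move=> /asboolP h; apply/asboolP => E rE sE tE cE EX.
  exact: sE (h E rE sE tE cE EX).
by move=> x y; apply/idP/idP; exact: H.
Qed.

Local Lemma branching_rel_trans : transitive r.
Proof.
move=> y x z /asboolP xy /asboolP yz; apply/asboolP => E rE sE tE cE EX.
exact: (tE x y z (xy E rE sE tE cE EX) (yz E rE sE tE cE EX)).
Qed.

Definition branching_equiv : equiv_rel P :=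
  EquivRel r branching_rel_refl branching_rel_sym branching_rel_trans.

Definition branching_space : topologicalType :=
  quotient_topology {eq_quot branching_equiv}.

Definition branching_proj : P -> branching_space :=
  \pi_({eq_quot branching_equiv}).

Lemma branching_projP x x' :
  branching_proj x = branching_proj x' <-> branching_rel x x'.
Proof. by split => [/eqmodP/asboolP//|h]; apply/eqmodP/asboolP. Qed.

Lemma branching_proj_surj y : exists x, branching_proj x = y.
Proof. by exists (repr y); exact: reprK. Qed.

Lemma branching_proj_closed (C : set branching_space) :
  closed (branching_proj @^-1` C) <-> closed C.
Proof. by rewrite -!openC. Qed.

Lemma branching_rel_closed :
  closed ([set z | branching_proj z.1 = branching_proj z.2]
            : set (kelleyfication (P * P))).
Proof.
apply/closed_kelleyP => K u tu.
rewrite (_ : _ @^-1` _ = \bigcap_(E in [set E : P -> P -> Prop |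
    [/\ (forall x, E x x), (forall x y, E x y -> E y x),
    (forall x y z, E x y -> E y z -> E x z),
    closed ([set z | E z.1 z.2] : set (kelleyfication (P * P))) &
    (forall x y (xy : target x = source y), E x (star xy))]])
    (u @^-1` [set z | E z.1 z.2])).
  by apply: closed_bigI => E [_ _ _ /closed_kelleyP cE _]; exact: cE.
apply/seteqP; split => [k /= /branching_projP h E [] *|k h].
  exact: (h E).
by apply/branching_projP => E rE sE tE cE EX; apply: (h E).
Qed.

Theorem branching_spaceP : is_branching_space branching_proj.
Proof.
have [wP kP] := path_space_cg X.
have cpi := quotient_cts branching_proj_closed.
split => //.
- split; last exact: (quotient_k_space branching_proj_closed).
  apply: (quotient_weak_hausdorff branching_proj_surj branching_proj_closed).
    exact: kP.
  exact: branching_rel_closed.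
- by move=> x y xy; apply/branching_projP => E rE sE tE cE; exact.
move=> Z phi [wZ kZ] cphi bphi.
have hphi x x' : branching_proj x = branching_proj x' -> phi x = phi x'.
  move=> /branching_projP
    /(_ (fun x x' => phi x = phi x')); apply => // [_ _ z -> //|].
  apply/closed_kelleyP => K u [cK hK cu]; apply: weak_hausdorff_eq_closed => //.
  - move=> k; apply: continuous_comp; last exact: cphi.
    by apply: continuous_comp; [exact: cu|exact: cvg_fst].
  - move=> k; apply: continuous_comp; last exact: cphi.
    by apply: continuous_comp; [exact: cu|exact: cvg_snd].
have psiE x : phi (repr (branching_proj x)) = phi x.
  by apply: hphi; exact: reprK.
exists (phi \o repr); split=> [|psi [_ <-]].
  split; last by apply/funext => x; exact: psiE.
  apply/continuous_closedP => C cC; apply/branching_proj_closed.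
  rewrite -comp_preimage (_ : _ \o _ = phi); first exact: closed_preimage.
  by apply/funext => x; exact: psiE.
by apply/funext => y /=; congr psi; exact: reprK.
Qed.

End branching.

(* Main.v *)
(** The branching space is functorial by its universal property. A path in
    [FLOW X Y] is, by the exponential law, a continuous map
    [[0, 1] * path_space X -> path_space Y]. It descends to
    [[0, 1] * BX -> BY] because [hX] is a quotient map and remains one after
    taking the product with a compact Hausdorff space; this makes the
    functor send S-homotopies to homotopies. *)
From mathcomp Require Import all_boot all_order all_algebra.
From mathcomp Require Import all_classical all_reals topology.
From mathcomp Require Import normedtype.
Require Import Defs.

Set Implicit Arguments.
Unset Strict Implicit.
Unset Printing Implicit Defensive.

Import Order.TTheory GRing.Theory Num.Theory.
Import numFieldNormedType.Exports.

Local Open Scope classical_set_scope.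
Local Open Scope ring_scope.

(** * Universal branching maps as quotient maps *)

Section universal_property.
Context (X : flow) (B : topologicalType) (h : path_space X -> B).
Context (bh : is_branching_space h).

Lemma branching_space_ext (Z : topologicalType) (a b : B -> Z) :
  compactly_generated Z -> continuous a -> continuous b ->
  a \o h = b \o h -> a = b.
Proof.
move=> cgZ ca cb ab; have [_ ch compat univ] := bh.
have [||psi [_ uniq]] := univ Z (a \o h) cgZ.
- by move=> x; apply: continuous_comp; [exact: ch|exact: ca].
- by move=> x y xy /=; rewrite (compat x y xy).
by rewrite -(uniq a) // -(uniq b).
Qed.

(** The two universal properties supply [p] and [q], and uniqueness forces [p \o q] to be the
    identity. This transfers surjectivity and the quotient topology from the explicit quotient to an
    arbitrary universal [h]. *)
Lemma branching_space_retract : exists (p : branching_space X -> B)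
    (q : B -> branching_space X),
  [/\ continuous q, cancel q p & p \o @branching_proj X = h].
Proof.
have [cgB ch compat univ] := bh.
have [cgQ cpi compatpi univpi] := branching_spaceP X.
have [p [[cp pE] _]] := univpi _ _ cgB ch compat.
have [q [[cq qE] _]] := univ _ _ cgQ cpi compatpi.
exists p, q; split => // b.
have -> // : p (q b) = (p \o q) b by [].
suff -> : p \o q = idfun by [].
apply: branching_space_ext => //.
- by move=> x; apply: continuous_comp; [exact: cq|exact: cp].
- by move=> x; exact: cvg_id.
- by rewrite -compA qE pE.
Qed.

Lemma branching_space_surj b : exists x, h x = b.
Proof.
have [p [q [_ qK <-]]] := branching_space_retract.
by have [x xE] := branching_proj_surj (q b); exists x; rewrite /= xE qK.
Qed.

(** Since [h] factors as [p \o branching_proj], a closed [h @^-1] C[makes]p @^-1[C] closed in the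
    explicit quotient; pulling this back along the section [q] recovers [C]. *)
Lemma branching_space_closed (C : set B) : closed (h @^-1` C) <-> closed C.
Proof.
have [_ ch _ _] := bh; split; last exact: closed_preimage.
have [p [q [cq qK <-]]] := branching_space_retract.
rewrite comp_preimage => /branching_proj_closed/(closed_preimage cq).
by congr closed; apply/seteqP; split => b /=; rewrite qK.
Qed.

End universal_property.

(** * Functoriality of the branching space *)

Section functoriality.
Context (X Y : flow) (BX BY : topologicalType).
Context (hX : path_space X -> BX) (hY : path_space Y -> BY).
Context (bX : is_branching_space hX) (bY : is_branching_space hY).

Lemma branching_map_subproof (f : flow_morphism X Y) :
  exists psi : BX -> BY, continuous psi /\ psi \o hX = hY \o path_map f.
Proof.
have [_ _ _ univ] := bX; have [cgY cY compat _] := bY.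
have [||psi [psiP _]] := univ BY (hY \o path_map f) cgY; last by exists psi.
- by move=> x; apply: continuous_comp; [exact: path_map_continuous|exact: cY].
move=> x y xy /=.
have fxy : target (path_map f x) = source (path_map f y).
  by rewrite target_path_map source_path_map xy.
by rewrite (path_map_star xy fxy); exact: compat.
Qed.

Definition branching_map (f : flow_morphism X Y) : BX -> BY :=
  projT1 (cid (branching_map_subproof f)).

Lemma branching_map_continuous f : continuous (branching_map f).
Proof. by rewrite /branching_map; case: cid => psi []. Qed.

Lemma branching_map_proj f : branching_map f \o hX = hY \o path_map f.
Proof. by rewrite /branching_map; case: cid => psi []. Qed.

End functoriality.

Lemma branching_map_id (X : flow) (B : topologicalType)
    (h : path_space X -> B) (b : is_branching_space h) :
  branching_map b b (flow_id X) = idfun.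
Proof.
have [cgB _ _ _] := b; apply: (branching_space_ext b cgB).
- exact: branching_map_continuous.
- by move=> x; exact: cvg_id.
- by rewrite branching_map_proj.
Qed.

Lemma branching_map_comp (X Y Z : flow) (BX BY BZ : topologicalType)
    (hX : path_space X -> BX) (hY : path_space Y -> BY)
    (hZ : path_space Z -> BZ) (bX : is_branching_space hX)
    (bY : is_branching_space hY) (bZ : is_branching_space hZ)
    (g : flow_morphism Y Z) (f : flow_morphism X Y) :
  branching_map bX bZ (flow_comp g f) =
  branching_map bY bZ g \o branching_map bX bY f.
Proof.
have [cgZ _ _ _] := bZ; apply: (branching_space_ext bX cgZ).
- exact: branching_map_continuous.
- by move=> x; apply: continuous_comp; exact: branching_map_continuous.
- by rewrite -compA !branching_map_proj compA branching_map_proj.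
Qed.

(** * Evaluation of continuous families of morphisms *)

(** The inclusion of the path summand into the total space is continuous and open, so [A] and [U]
    define a subbasic compact-open set [W], to be pulled back along [total_map]. *)
Lemma FLOW_open (X Y : flow) (A : set (path_space X)) (U : set (path_space Y)) :
  compact A -> open U ->
  open ([set f | path_map f @` A `<=` U] : set (FLOW X Y)).
Proof.
move=> cA oU.
pose W : set {compact-open, total_space X -> total_space Y} :=
  [set g | g @` (existT (flow_part X) false @` A) `<=`
           existT (flow_part Y) false @` U].
have oW : open W.
  apply: compact_open_open; last exact: (@existT_open_map _ (flow_part Y) false U oU).
  apply: continuous_compact => //; apply: continuous_subspaceT.
  exact: (@existT_continuous _ (flow_part X) false).
have -> : [set f : FLOW X Y | path_map f @` A `<=` U] = @total_map X Y @^-1` W.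
  apply/seteqP; split => f /= fAU.
    move=> _ [_ [a Aa <-] <-]; exists (path_map f a) => //.
    by apply: fAU; exists a.
  move=> _ [a Aa <-].
  have [|u Uu] := fAU (total_map f (existT _ false a)).
    by exists (existT _ false a) => //; exists a.
  by move=> e; rewrite -(existT_inj2 e).
have oV : open (@total_map X Y @^-1` W : set (initial_topology (@total_map X Y))).
  by apply: open_comp => // f _; exact: initial_continuous.
(* Openness in the Kelleyfication is openness of the preimages along test maps, which [oV]
   yields. *)
by move=> K u [_ _ cu]; apply: open_comp => // k _; exact: cu.
Qed.

(* Compact Hausdorff test spaces [K] suffice to check continuity, [path_space X]
   being a k-space. It is their local compactness that makes evaluation
   continuous: [path_space X] itself need not be locally compact. *)
Lemma FLOW_eval_continuous (T : topologicalType) (X Y : flow)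
    (G : T -> FLOW X Y) : compact [set: T] -> hausdorff_space T ->
  continuous G ->
  continuous (fun z : T * path_space X => path_map (G z.1) z.2).
Proof.
move=> cT hT cG; apply/continuous_closedP => C cC.
have [_ kX] := path_space_cg X.
apply: kprod_closed => // K u [cK hK cu].
rewrite -comp_preimage; apply: closed_preimage => // k0.
have cu1 : continuous (fun k => (u k).1).
  by move=> k; apply: continuous_comp; [exact: cu|exact: cvg_fst].
have cu2 : continuous (fun k => (u k).2).
  by move=> k; apply: continuous_comp; [exact: cu|exact: cvg_snd].
move=> V; rewrite nbhsE => -[U [oU /= Uk0] UV].
(* First freeze the morphism at [k0] and vary only the path. Regularity then gives a closed
   neighbourhood whose paths form a compact set sent into [U]. *)
have nU : nbhs k0 ((fun k => path_map (G (u k0).1) (u k).2) @^-1` U).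
  have cf : continuous (fun k => path_map (G (u k0).1) (u k).2).
    move=> k; exact: (continuous_comp (cu2 k) (path_map_continuous _ _ _ _)).
  by apply: cf; exact: open_nbhs_nbhs.
have [N nN clN] := @compact_regular K k0 setT hK cK filterT _ nU.
have cptN : compact ((fun k => (u k).2) @` closure N).
  apply: continuous_compact; first exact: continuous_subspaceT.
  by apply: (subclosed_compact _ cK) => //; exact: closed_closure.
(* Now vary the morphism: sending that compact set into [U] is an open condition. *)
have nO : nbhs k0 [set k |
    path_map (G (u k).1) @` ((fun k => (u k).2) @` closure N) `<=` U].
  have cGu : continuous (fun k => G (u k).1).
    by move=> k; apply: continuous_comp; [exact: cu1|exact: cG].
  apply: (cGu k0 [set f : FLOW X Y | path_map f @` _ `<=` U]).
  apply: open_nbhs_nbhs; split; first exact: FLOW_open.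
  by move=> _ [_ [k /clN Uk <-] <-].
apply: filterS (filterI nN nO) => k [Nk GU]; apply: UV; apply: GU.
by exists (u k).2 => //; exists k => //; exact: subset_closure.
Qed.

(** * The unit interval as a compact Hausdorff space *)

Lemma compact_set_type (S : topologicalType) (A : set S) :
  compact A -> compact [set: A].
Proof.
move=> cA F FF _.
have FA : (set_val @ F) A.
  by apply: (@filterS _ F _ setT); [move=> z _; exact: set_valP|exact: filterT].
have [s [As cls]] := cA _ (fmap_proper_filter (set_val : A -> S) FF) FA.
exists (exist _ s (mem_set As)); split => // B C FB [_ [[O oO <-] /= Os OC]].
have FB' : (set_val @ F) (set_val @` B).
  by apply: (@filterS _ F _ B) => // z Bz; exists z.
have [_ [[z Bz <-] Oz]] := cls _ _ FB' (open_nbhs_nbhs (conj oO Os)).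
by exists z; split => //; exact: OC.
Qed.

(** Homotopies are continuous within a subset of [R], while evaluation and the product with a
    quotient map require a compact Hausdorff space. This lemma passes to the subtype; the next one
    returns from it. *)
Lemma within_set_type_continuous (S Z : topologicalType) (A : set S)
    (f : S -> Z) :
  {within A, continuous f} -> continuous (f \o (set_val : A -> S)).
Proof.
move=> /subspace_continuousP cf x U /(cf _ (set_valP x)) /= nU.
have cv : continuous (set_val : A -> S) by exact: initial_continuous.
have nAU : nbhs x (set_val @^-1` [set y | A y -> U (f y)]) by exact: cv.
by apply: filterS nAU => y /=; apply; exact: set_valP.
Qed.

Lemma set_type_within_continuous (S T Z : topologicalType) (A : set S)
    (f : S * T -> Z) :
  continuous (fun z : A * T => f (set_val z.1, z.2)) ->
  {within A `*` [set: T], continuous f}.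
Proof.
move=> cf; apply/subspace_continuousP => -[s t] [/= As _] U nU.
have [[V W] /= [[_ [[O oO <-] /= Os OV]] nW] VWU] :=
  cf (exist _ s (mem_set As), t) U nU.
exists (O, W); first by split => //=; exact: open_nbhs_nbhs.
move=> [s' t'] /= [Os' Wt'] [As' _].
by apply: (VWU (exist _ s' (mem_set As'), t')); split => //; exact: OV.
Qed.

(** * From S-homotopies to homotopies *)

Section homotopy_invariance.
Context (R : realType) (X Y : flow) (BX BY : topologicalType).
Context (hX : path_space X -> BX) (hY : path_space Y -> BY).
Context (bX : is_branching_space hX) (bY : is_branching_space hY).

Lemma branching_map_homotopic (f g : flow_morphism X Y) :
  S_homotopic R f g ->
  homotopic R (branching_map bX bY f) (branching_map bX bY g).
Proof.
move=> [H [cH <- <-]].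
exists (fun z => branching_map bX bY (H z.1) z.2); split => //.
apply: set_type_within_continuous.
set I := set_type _.
have cI : compact [set: I] by apply/compact_set_type/segment_compact.
have hI : hausdorff_space I.
  by apply: set_type_hausdorff; exact: Rhausdorff.
pose G : I -> FLOW X Y := H \o set_val.
have cG : continuous G by exact: within_set_type_continuous.
have cev := FLOW_eval_continuous cI hI cG.
have [_ cY _ _] := bY.
apply/continuous_closedP => C cC.
apply: (whitehead (branching_space_surj bX) (branching_space_closed bX)) => //.
(* Before passing to the quotient, the homotopy is evaluation followed by [hY], by naturality of
   [branching_map]. *)
rewrite (_ : _ @^-1` _ = (fun z => hY (path_map (G z.1) z.2)) @^-1` C).
  apply: closed_preimage => // z.
  by apply: continuous_comp; [exact: cev|exact: cY].
apply/seteqP; split => -[t x] /=;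
  by have /(congr1 (@^~ x)) /= -> := branching_map_proj bX bY (G t).
Qed.

End homotopy_invariance.

Theorem propositionB1 (R : realType) (X Y : flow)
    (BX BY : topologicalType)
    (hX : path_space X -> BX) (hY : path_space Y -> BY)
    (bX : is_branching_space hX) (bY : is_branching_space hY) :
  S_homotopy_equivalent R X Y -> homotopy_equivalent R BX BY.
Proof.
move=> [f [g [gf fg]]].
exists (branching_map bX bY f), (branching_map bY bX g); split.
- exact: branching_map_continuous.
- exact: branching_map_continuous.
- rewrite -(branching_map_comp bX bY bX) -(branching_map_id bX).
  exact: branching_map_homotopic.
- rewrite -(branching_map_comp bY bX bY) -(branching_map_id bY).
  exact: branching_map_homotopic.
Qed.
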